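(* Let $A,B$ be groups with $B=\mathrm{sgp}\langle Y\mid R\rangle$, where $R=\{v=h_v\mid v\in\Omega\}$ is a minimal Gröbner–Shirshov basis of $B$ with respect to the deg-lex order on $Y^*$. Let $\{\psi_y\}_{y\in Y}$ be automorphisms of $A$, and let $\{(v)\mid v\in\Omega\}\subseteq A$ be a factor set such that $(v)=1$ whenever the relation $v=h_v$ has the form $yy'=1$ with $y,y'\in Y$ letters representing mutually inverse elements of $B$. Let $G=E(A,Y,a^y,(v))=\mathrm{sgp}\langle A_1\cup Y\mid S\rangle$. Then $S$ is a Gröbner–Shirshov basis in $k\langle A_1\cup Y\rangle$ with respect to the tower order if and only if both of the following hold in $A$: (1) for every $v\in\Omega$ and every $a\in A$, $(v)\,a^{v}=a^{h_v}\,(v)$; (2) for every intersection composition of $R$, i.e. every $w=v_1c=dv_2$ with $v_1,v_2\in\Omega$, $c,d\in Y^*$ and $\deg v_1+\deg v_2>\deg w$, and for every choice of reduction sequences as in the context, $\xi_{(v_1,v_2)_w}=\zeta_{(v_1,v_2)_w}$. Moreover, if these conditions hold, then $G$ is a Schreier extension of $A$ by $B$ in the natural way. That is, the map $A\to G$, $a\mapsto a$, is injective; its image is a normal subgroup of $G$; and the map sending each letter $y\in Y$ to its image in $G$ induces an isomorphism $B\cong G/A$. Furthermore, every element of $G$ can be written uniquely as $ba$ with $a\in A$ and $b\in Y^*$ an $R$-irreducible word.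
   Context: Let $k$ be a field and let $X^*$ be the free monoid on a set $X$, with empty word $1$. For a monic polynomial $f\in k\langle X\rangle$, $\bar f$ denotes its leading word with respect to a fixed total order on $X^*$. Compositions of two monic polynomials $f,g$ are defined as follows: - If $w=\bar f b=a\bar g$ with $a,b\in X^*$ and $\deg\bar f+\deg\bar g>\deg w$, then $(f,g)_w=fb-ag$ is an intersection composition. - If $w=\bar f=a\bar g b$ with $a,b\in X^*$, then $(f,g)_w=f-agb$ is an inclusion composition. A composition is trivial modulo $S$ if it equals $\sum\alpha_i a_is_ib_i$ with $\alpha_i\in k$, $a_i,b_i\in X^*$, $s_i\in S$, and $a_i\bar{s_i}b_i<w$. A set $S$ of monic polynomials is a Gröbner–Shirshov basis if every composition of elements of $S$ is trivial modulo $S$. A relation $u=v$ is identified with the polynomial $u-v$. The notation $\mathrm{sgp}\langle X\mid S\rangle$ denotes the monoid presented by generators $X$ and relations $S$. Standing setup. Let $A,B$ be groups, and let $B=\mathrm{sgp}\langle Y\mid R\rangle$ with $R=\{v=h_v\mid v\in\Omega\}$. We assume $R$ is a minimal Gröbner–Shirshov basis with respect to the deg-lex order on $Y^*$ (for a fixed total order on $Y$). This means: - $v$ is the leading word of $f_v=v-h_v$; - all compositions of the $f_v$ are trivial modulo $R$; - no $v$ is a subword of a different $v'$. Let $A_1=A\setminus\{1\}$, totally ordered, and give $A_1^*$ the deg-lex order. For each $y\in Y$ let $\psi_y$ be an automorphism of $A$, and write $a^y=\psi_y(a)$. For $u=y_1\cdots y_r\in Y^*$ write $a^u=\psi_{y_r}(\cdots\psi_{y_1}(a)\cdots)$,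 so that $(a^{y_1})^{y_2}=a^{y_1y_2}$; also $a^1=a$. A factor set of $B$ in $A$ is a family $\{(v)\mid v\in\Omega\}$ of elements of $A$. Define $$G=E(A,Y,a^y,(v))=\mathrm{sgp}\langle A_1\cup Y\mid S\rangle,$$ where $$S=\{aa'=[aa'],\ v=h_v\cdot(v),\ ay=ya^y \mid a,a'\in A_1,\ v\in\Omega,\ y\in Y\}.$$ Here $[aa']$ is the product in $A$, and elements of $A$ appearing in words are read as letters of $A_1$, with $1$ read as the empty word. Tower order on $(A_1\cup Y)^*$. Write each word uniquely as $d=e_1y_1\cdots e_ty_te_{t+1}$ with $e_l\in A_1^*$ and $y_l\in Y$, and set $wt(d)=(t,y_1,\dots,y_t,e_1,\dots,e_{t+1})$. Then $d\prec d'$ if and only if $wt(d)<wt(d')$ lexicographically, where: - $t$ is compared as a natural number; - the $y_l$ are compared in the order of $Y$; - the $e_l$ are compared in the deg-lex order of $A_1^*$. The functions $\xi,\zeta$. Let $w=v_1c=dv_2$ be an intersection of leading words of $R$. Since $R$ is a Gröbner–Shirshov basis, the words $dh_{v_2}$ and $h_{v_1}c$ both reduce modulo $R$ to a common $R$-irreducible word $z$. An elementary reduction step replaces a subword $pvq$ with $p\,h_v\,q$, where $p,q\in Y^*$ and $v\in\Omega$; we assign to this step the element $\gamma=(v)^q\in A$. Choose a sequence of elementary reductions from $dh_{v_2}$ to $z$, with assigned elements $\gamma_1,\dots,\gamma_m$ in order. Set $$\xi_{(v_1,v_2)_w}=\gamma_m\cdots\gamma_1\,(v_2).$$ Similarly,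 choose a sequence from $h_{v_1}c$ to $z$ with assigned elements $\delta_1,\dots,\delta_n$, and set $$\zeta_{(v_1,v_2)_w}=\delta_n\cdots\delta_1\,(v_1)^c.$$
   Formalization: The total orders on Y and on A_1 are required to be well-orders; for arbitrary total orders the equivalence fails, e.g. A = (Q,+) with its usual order, B = sgp<y | yy=1>, a^y = 2a and trivial factor set. *)

(* Defs.v *)
From HB Require Import structures.
From mathcomp Require Import all_boot all_order all_algebra.
From Stdlib Require List.
Set Implicit Arguments. Unset Strict Implicit. Unset Printing Implicit Defensive.

(* Noncommutative polynomials k<X>, represented as finite formal sums   *)
(* of (coefficient, word); two such sums are equal as polynomials       *)
(* (peq) when all their coefficients agree.                             *)
Section Poly.
Variables (k : fieldType) (X : eqType).

Definition kpoly := seq (k * seq X).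

Definition pcoef (p : kpoly) (u : seq X) : k :=
  (\sum_(t <- p) (if t.2 == u then t.1 else 0))%R.

Definition pscale (c : k) (p : kpoly) : kpoly := [seq ((c * t.1)%R, t.2) | t <- p].

Definition pmulw (a : seq X) (p : kpoly) (b : seq X) : kpoly :=
  [seq (t.1, a ++ t.2 ++ b) | t <- p].

Definition psub (p q : kpoly) : kpoly := p ++ pscale (-1)%R q.

Definition peq (p q : kpoly) : Prop := forall u, pcoef p u = pcoef q u.

Definition binom (u v : seq X) : kpoly := [:: (1%R, u); ((-1)%R, v)].

Variable lt : rel (seq X).

Definition is_lead (p : kpoly) (w : seq X) : Prop :=
  pcoef p w != 0%R /\ forall u, pcoef p u != 0%R -> u = w \/ lt u w.

Definition monic (p : kpoly) : Prop := exists w, is_lead p w /\ pcoef p w = 1%R.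

Definition trivial_mod (S : kpoly -> Prop) (h : kpoly) (w : seq X) : Prop :=
  exists l : seq (k * seq X * kpoly * seq X),
    (forall t, Coq.Lists.List.In t l ->
       let '(al, a, s, b) := t in
       S s /\ exists ls, is_lead s ls /\ lt (a ++ ls ++ b) w)
    /\ peq h (flatten [seq (let '(al, a, s, b) := t in pscale al (pmulw a s b)) | t <- l]).

Definition GSB (S : kpoly -> Prop) : Prop :=
  (forall f, S f -> monic f) /\
  forall f g wf wg, S f -> S g -> is_lead f wf -> is_lead g wg ->
   (forall a b, wf ++ b = a ++ wg -> (size (wf ++ b) < size wf + size wg)%N ->
       trivial_mod S (psub (pmulw [::] f b) (pmulw a g [::])) (wf ++ b)) /\
   (forall a b, wf = a ++ wg ++ b -> trivial_mod S (psub f (pmulw a g b)) wf).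

End Poly.

Definition polys (k : fieldType) (X : eqType) (rels : seq X -> seq X -> Prop)
  (p : kpoly k X) : Prop := exists u v, rels u v /\ p = binom k u v.

Fixpoint lexlt (T : eqType) (lt : rel T) (u v : seq T) : bool :=
  match u, v with
  | x :: u', y :: v' => lt x y || ((x == y) && lexlt lt u' v')
  | [::], _ :: _ => true
  | _, _ => false
  end.

Definition deglex (T : eqType) (lt : rel T) (u v : seq T) : bool :=
  (size u < size v)%N || ((size u == size v) && lexlt lt u v).

Definition strict_total_wo (T : eqType) (lt : rel T) : Prop :=
  (forall x, ~~ lt x x) /\ (forall x y z, lt x y -> lt y z -> lt x z) /\
  (forall x y, x != y -> lt x y || lt y x) /\ well_founded (fun x y => lt x y).

Definition is_group (A : Type) (mul : A -> A -> A) (one : A) (inv : A -> A) : Prop :=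
  (forall x y z, mul x (mul y z) = mul (mul x y) z) /\
  (forall x, mul one x = x) /\ (forall x, mul x one = x) /\
  (forall x, mul (inv x) x = one) /\ (forall x, mul x (inv x) = one).

Definition is_aut (A : Type) (mul : A -> A -> A) (f : A -> A) : Prop :=
  (forall x y, f (mul x y) = mul (f x) (f y)) /\ bijective f.

(* the congruence on X^* generated by a set of relations: equality in
   sgp<X | rels> *)
Inductive cong (X : Type) (rels : seq X -> seq X -> Prop) : seq X -> seq X -> Prop :=
| cong_step a b u v : rels u v -> cong rels (a ++ u ++ b) (a ++ v ++ b)
| cong_refl u : cong rels u u
| cong_sym u v : cong rels u v -> cong rels v u
| cong_trans u v w : cong rels u v -> cong rels v w -> cong rels u w.

Definition monoid_is_group (X : Type) (rels : seq X -> seq X -> Prop) : Prop :=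
  forall u : seq X, exists u', cong rels (u ++ u') [::] /\ cong rels (u' ++ u) [::].

Section Ext.
Variables (A : eqType) (oneA : A).

Definition A1 := {a : A | a != oneA}.

Definition letter (Y : Type) := (A1 + Y)%type.

(* an element of A read as a word: a letter of A_1, 1 read as the empty word *)
Definition aw (Y : Type) (a : A) : seq (letter Y) :=
  match (insub a : option A1) with Some a1 => [:: inl a1] | None => [::] end.

Variable Y : eqType.

Definition yword (u : seq Y) : seq (letter Y) := map inr u.

Definition ys (d : seq (letter Y)) : seq Y :=
  pmap (fun l => if l is inr y then Some y else None) d.

(* the blocks e_1, ..., e_{t+1} in A_1^* of d = e_1 y_1 ... e_t y_t e_{t+1} *)
Fixpoint blocks (d : seq (letter Y)) : seq (seq A1) :=
  match d with
  | [::] => [:: [::]]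
  | inl a :: d' => match blocks d' with
                   | e :: r => (a :: e) :: r
                   | [::] => [:: [:: a]]
                   end
  | inr _ :: d' => [::] :: blocks d'
  end.

Definition tower (ltA1 : rel A1) (ltY : rel Y) (d d' : seq (letter Y)) : bool :=
  (size (ys d) < size (ys d'))%N ||
  ((size (ys d) == size (ys d')) &&
   (lexlt ltY (ys d) (ys d') ||
    ((ys d == ys d') && lexlt (deglex ltA1) (blocks d) (blocks d')))).

Variables (mulA : A -> A -> A) (psi : Y -> A -> A)
  (Omega : seq Y -> Prop) (h : seq Y -> seq Y) (fs : seq Y -> A).

Definition actw (a : A) (u : seq Y) : A := foldl (fun b y => psi y b) a u.

Definition relsR (u v : seq Y) : Prop := Omega u /\ v = h u.

Definition relsS (u v : seq (letter Y)) : Prop :=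
  (exists a a' : A1, u = [:: inl a; inl a'] /\ v = aw Y (mulA (val a) (val a')))
  \/ (exists w, Omega w /\ u = yword w /\ v = yword (h w) ++ aw Y (fs w))
  \/ (exists (a : A1) (y : Y), u = [:: inl a; inr y] /\ v = inr y :: aw Y (psi y (val a))).

Definition R_irreducible (z : seq Y) : Prop :=
  forall p q v, Omega v -> z <> p ++ v ++ q.

(* rseq x z g : there is a sequence of elementary reductions from x to z
   whose assigned elements gamma_1, ..., gamma_m satisfy
   g = gamma_m ... gamma_1, where the step p v q -> p h_v q is assigned
   gamma = (v)^q. *)
Inductive rseq : seq Y -> seq Y -> A -> Prop :=
| rseq_nil x : rseq x x oneA
| rseq_cons p v q z g : Omega v -> rseq (p ++ h v ++ q) z g ->
    rseq (p ++ v ++ q) z (mulA g (actw (fs v) q)).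

End Ext.

Arguments polys k {X} rels p.

(* Main.v *)
Require Import Defs.
From HB Require Import structures.
From mathcomp Require Import all_boot all_order all_algebra.
From mathcomp Require Import boolp ring.
From Stdlib Require Import Relations.

(** By linearity, a composition of binomials [u - v], [u' - v'] at [w] is trivial
    if and only if the two words obtained from [w] are connected by relations
    between words below [w]; so a Gröbner-Shirshov basis of binomials is a
    string rewriting system with connected critical pairs, and by well-founded
    induction on the order every word then has a unique normal form.
    For [S] the S-irreducible words include all [b a] with [b] R-irreducible and
    [a] in [A]. The words [a v] and [v1 c = d v2] each reduce to two words [b a]
    and [b a'] with the same [b], and [a = a'] exactly when (1), respectively
    (2), holds; the remaining critical pairs are joinable because [A] is a group
    and the [psi y] are automorphisms. Conversely uniqueness of the normal form
    [b a] in [G] gives (1) and (2), and the extension properties. *)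

Set Implicit Arguments. Unset Strict Implicit. Unset Printing Implicit Defensive.

(** * Linear forms on noncommutative polynomials *)

Section LinearForms.
Variables (k : fieldType) (X : eqType).
Implicit Types (p q : kpoly k X) (phi : seq X -> k).
Import GRing.Theory.
Local Open Scope ring_scope.

Definition linform phi p : k := \sum_(t <- p) t.1 * phi t.2.

Lemma linform_coef phi p (s : seq (seq X)) :
  uniq s -> {subset map snd p <= s} ->
  linform phi p = \sum_(u <- s) pcoef p u * phi u.
Proof.
move=> us ps; rewrite /pcoef.
under [RHS]eq_bigr do rewrite mulr_suml.
rewrite exchange_big /=; apply: eq_big_seq => t tp.
rewrite (bigD1_seq t.2) //=; last by apply/ps/map_f.
by rewrite eqxx big1 ?addr0 // => u /negPf; rewrite eq_sym => ->; rewrite mul0r.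
Qed.

(** Both sums regroup over one duplicate-free list holding all words of [p] and [q], where only
    coefficients matter; so [linform] is well defined on polynomials. *)
Lemma peq_linform phi p q : peq p q -> linform phi p = linform phi q.
Proof.
move=> e; pose s := undup (map snd p ++ map snd q).
rewrite !(@linform_coef phi _ s) ?undup_uniq //; first 1 last.
- by move=> u; rewrite mem_undup mem_cat => ->; rewrite orbT.
- by move=> u; rewrite mem_undup mem_cat => ->.
by apply: eq_bigr => u _; rewrite e.
Qed.

Lemma pcoef_cat p q u : pcoef (p ++ q) u = pcoef p u + pcoef q u.
Proof. by rewrite /pcoef big_cat. Qed.

Lemma pcoef_cons c v p u : pcoef ((c, v) :: p) u = (if v == u then c else 0) + pcoef p u.
Proof. by rewrite /pcoef big_cons. Qed.

Lemma pcoef_nil u : pcoef ([::] : kpoly k X) u = 0.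
Proof. by rewrite /pcoef big_nil. Qed.

Lemma pcoef_scale c p u : pcoef (pscale c p) u = c * pcoef p u.
Proof.
rewrite /pcoef /pscale big_map mulr_sumr; apply: eq_bigr => t _ /=.
by case: ifP => //; rewrite mulr0.
Qed.

Definition pcoefE := (pcoef_cat, pcoef_cons, pcoef_nil, pcoef_scale).

Lemma pcoef_binom (u v w : seq X) :
  pcoef (binom k u v) w = (u == w)%:R - (v == w)%:R.
Proof.
by rewrite /binom !pcoefE addr0; do 2 case: eqP => _; rewrite ?subr0 ?sub0r ?oppr0 ?addr0 ?add0r.
Qed.

End LinearForms.

(** * String rewriting systems and their normal forms *)

Section Rewriting.
Variables (X : eqType) (lt : rel (seq X)) (rels : seq X -> seq X -> Prop).
Implicit Types (u v w x y z a b : seq X).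

Inductive red : seq X -> seq X -> Prop :=
| red_step a u v b : rels u v -> red (a ++ u ++ b) (a ++ v ++ b).

Definition reds := clos_refl_trans _ red.

(** Connectedness through words smaller than [w]. Bounding the source of each step suffices when the
    rules decrease words. *)
Definition below w := clos_refl_sym_trans _ (fun x y => red x y /\ lt x w).

Definition normal x := forall y, ~ red x y.

Definition joinable x y := exists2 z, reds x z & reds y z.

Lemma reds_trans x y z : reds x y -> reds y z -> reds x z.
Proof. exact: rt_trans. Qed.

Lemma red_ctx a b x y : red x y -> red (a ++ x ++ b) (a ++ y ++ b).
Proof.
case=> a' u v b' uv; have := red_step (a ++ a') (b' ++ b) uv.
by rewrite -!catA.
Qed.

Lemma reds_ctx a b x y : reds x y -> reds (a ++ x ++ b) (a ++ y ++ b).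
Proof.
elim=> [? ? /(red_ctx a b)|?|? y' ? _ h1 _ h2]; first exact: rt_step.
  exact: rt_refl.
exact: rt_trans h1 h2.
Qed.

Lemma reds_catl a x y : reds x y -> reds (a ++ x) (a ++ y).
Proof. by move=> /(reds_ctx a [::]); rewrite !cats0. Qed.

Lemma reds_catr b x y : reds x y -> reds (x ++ b) (y ++ b).
Proof. exact: (reds_ctx [::]). Qed.

Lemma red_rel u v : rels u v -> reds u v.
Proof. by move=> /(red_step [::] [::]); rewrite !cats0; apply: rt_step. Qed.

Lemma reds_cong x y : reds x y -> cong rels x y.
Proof.
elim=> [? ? [] *|?|? y' ? _ h1 _ h2]; first exact: cong_step.
  exact: cong_refl.
exact: cong_trans h1 h2.
Qed.

Lemma reds_normal x y : reds x y -> normal x -> y = x.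
Proof.
move=> /(clos_rt_rt1n _ _ _ _) xy nx; move: xy; case=> // z t xz _.
by case: (nx _ xz).
Qed.

Hypotheses (lt_irr : forall x, ~~ lt x x)
  (lt_trans : forall x y z, lt x y -> lt y z -> lt x z)
  (lt_ctx : forall a b x y, lt x y -> lt (a ++ x ++ b) (a ++ y ++ b))
  (lt_wf : well_founded (fun x y => lt x y))
  (rels_lt : forall u v, rels u v -> lt v u).

Lemma red_lt x y : red x y -> lt y x.
Proof. by case=> a u v b uv; apply/lt_ctx/rels_lt. Qed.

Lemma reds_below w x y : reds x y -> lt x w -> below w x y.
Proof.
move=> h; have {h} := clos_rt_rt1n _ _ _ _ h; elim=> [?|x' y' z' xy _ IH] xw; first exact: rst_refl.
apply: (rst_trans _ _ _ y'); first by apply: rst_step.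
by apply/IH/lt_trans/xw/red_lt.
Qed.

Lemma joinable_below w x y : joinable x y -> lt x w -> lt y w -> below w x y.
Proof.
move=> [z xz yz] xw yw; apply: (rst_trans _ _ _ z); first exact: reds_below.
by apply/rst_sym/reds_below.
Qed.

Lemma below_ctx a b w x y : below w x y -> below (a ++ w ++ b) (a ++ x ++ b) (a ++ y ++ b).
Proof.
elim=> [x' y' [xy xw]|?|? ? _|? y' ? _ h1 _ h2].
- by apply: rst_step; split; [apply: red_ctx | apply: lt_ctx].
- exact: rst_refl.
- exact: rst_sym.
- exact: rst_trans h1 h2.
Qed.

Lemma normal_form_exists x : exists2 z, reds x z & normal z.
Proof.
elim/(well_founded_ind lt_wf): x => x IH.
have [[y xy]|nx] := EM (exists y, red x y).
  have [z yz nz] := IH _ (red_lt xy); exists z => //.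
  by apply: rt_trans yz; apply: rt_step.
by exists x; [apply: rt_refl | move=> y xy; apply: nx; exists y].
Qed.

(** * Trivial compositions and connected critical pairs *)

Section Criterion.
Variable k : fieldType.

(** If [w] is not [u], its nonzero coefficient forces [w = v]; but [u] also has a nonzero
    coefficient and would have to lie below [v]. *)
Lemma binom_lead u v w : rels u v -> is_lead lt (binom k u v) w -> w = u.
Proof.
move=> /rels_lt vu [wn0 wmax]; apply/eqP; apply: contraNT (lt_irr v) => nwu.
have wv: w = v.
  apply/eqP; apply: contraNT wn0 => nwv.
  by rewrite pcoef_binom ![_ == w]eq_sym (negPf nwu) (negPf nwv) /= GRing.subr0.
case: (wmax u) => [|eu|]; last 2 first.
- by rewrite eu eqxx in nwu.
- by rewrite wv; apply: lt_trans vu.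
rewrite pcoef_binom eqxx; have [ev|_] /= := eqVneq v u; last by rewrite GRing.subr0 GRing.oner_neq0.
by rewrite ev (negPf (lt_irr _)) in vu.
Qed.

Lemma lead_binom u v : rels u v -> is_lead lt (binom k u v) u /\ pcoef (binom k u v) u = 1%R.
Proof.
move=> /rels_lt vu.
have nvu: v != u by apply: contraTneq vu => ->.
have c1: pcoef (binom k u v) u = 1%R by rewrite pcoef_binom eqxx (negPf nvu) /= GRing.subr0.
split=> //; split=> [|w]; first by rewrite c1 GRing.oner_neq0.
rewrite pcoef_binom; have [->|_] := eqVneq u w; first by left.
by have [<-|_] := eqVneq v w; [right | rewrite GRing.subr0 eqxx].
Qed.

(* The linear form sending the words connected to [x] to 1 and the others to 0
   kills every [a s b] occurring in a trivial representation. *)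
Lemma trivial_below p w x y :
  trivial_mod lt (polys k rels) p w -> peq p (binom k x y) -> below w x y.
Proof.
move=> [l [lS /= pl]] pxy.
pose phi u : k := if `[< below w x u >] then 1%R else 0%R.
have: linform phi (binom k x y) = 0%R.
  rewrite -(@peq_linform _ _ phi
    (flatten [seq (let '(al, a, s, b) := t in pscale al (pmulw a s b)) | t <- l])); last first.
    by move=> u; rewrite -pl pxy.
  elim: l lS {pl} => [|[[[al a] s] b] l IH] lS /=; first by rewrite /linform big_nil.
  rewrite /linform big_cat -/(linform _ _) -/(linform _ (flatten _)) IH; last first.
    by move=> t tl; apply: lS; right.
  have /= [[u [v [uv ->]]] [ls [/(binom_lead uv) -> ltw]]] := lS _ (or_introl erefl).
  rewrite /linform !big_cons big_nil /= GRing.mulr1 GRing.mulrN1 !GRing.addr0.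
  have st: below w (a ++ u ++ b) (a ++ v ++ b) by apply: rst_step.
  have -> : phi (a ++ u ++ b) = phi (a ++ v ++ b).
    rewrite /phi; suff -> : `[< below w x (a ++ u ++ b) >] = `[< below w x (a ++ v ++ b) >] by [].
    apply/asboolP/asboolP => h; first exact: rst_trans h st.
    by apply: rst_trans h _; apply: rst_sym.
  by rewrite GRing.mulNr GRing.subrr.
rewrite /linform /binom !big_cons big_nil /= GRing.mul1r GRing.addr0 GRing.mulN1r.
rewrite {1}/phi asboolT; last exact: rst_refl.
rewrite /phi; case: asboolP => // _ /eqP.
by rewrite GRing.subr0 GRing.oner_eq0.
Qed.

(** A step contributes the single term [a (u - v) b]; reversing a path negates coefficients, and
    concatenating paths telescopes the differences. *)
Lemma below_trivial p w x y :
  below w x y -> peq p (binom k x y) -> trivial_mod lt (polys k rels) p w.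
Proof.
move=> xy pxy.
suff [l [lS ll]] : trivial_mod lt (polys k rels) (binom k x y) w.
  by exists l; split=> // u; rewrite pxy.
elim: xy => {p x y pxy} [_ _ [[a u v b uv] ltw]|x|x y _ [l [lS le]]|x y z _ [l [lS le]] _ [l' [lS' le']]].
- exists [:: (1%R, a, binom k u v, b)]; split=> [t [<-|//]|].
    split; first by exists u, v.
    by exists u; split=> //; case: (lead_binom uv).
  by move=> t; rewrite /= !GRing.mul1r.
- by exists [::]; split=> // u; rewrite pcoef_binom GRing.subrr pcoef_nil.
- exists [seq ((- t.1.1.1)%R, t.1.1.2, t.1.2, t.2) | t <- l]; split.
    move=> t /List.in_map_iff [[[[al a] s] b] [<- tl]] /=.
    exact: lS tl.
  move=> u; rewrite pcoef_binom -GRing.opprB -pcoef_binom le.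
  elim: l {lS le} => [|[[[al a] s] b] l IH] /=; first by rewrite pcoef_nil GRing.oppr0.
  by rewrite !pcoef_cat !pcoef_scale GRing.opprD GRing.mulNr IH.
- exists (l ++ l'); split.
    by move=> t /(List.in_app_or l l') [/lS|/lS'].
  move=> u; rewrite map_cat flatten_cat pcoef_cat -le -le' !pcoef_binom.
  by rewrite GRing.addrA GRing.subrK.
Qed.

Definition critical_pairs_below :=
  (forall u v u' v' a b, rels u v -> rels u' v' -> u ++ b = a ++ u' ->
     (size (u ++ b) < size u + size u')%N -> below (u ++ b) (v ++ b) (a ++ v')) /\
  (forall u v u' v' a b, rels u v -> rels u' v' -> u = a ++ u' ++ b ->
     below u v (a ++ v' ++ b)).

Lemma GSB_critical_pairs : GSB lt (polys k rels) <-> critical_pairs_below.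
Proof.
(* The two copies of the common word cancel, leaving the difference of its two one-step reducts. *)
have oc u v u' v' a b : u ++ b = a ++ u' ->
    peq (psub (pmulw [::] (binom k u v) b) (pmulw a (binom k u' v') [::]))
      (binom k (a ++ v') (v ++ b)).
  move=> e w; rewrite pcoef_binom /psub /= !pcoefE /= !cats0 e.
  do 3 case: (_ == w) => /=; ring.
(* An inclusion is treated as an overlap with empty right context, the second binomial being
   extended by [b]. *)
have ic u v u' v' a b : u = a ++ u' ++ b ->
    peq (psub (binom k u v) (pmulw a (binom k u' v') b)) (binom k (a ++ v' ++ b) v).
  move=> e; have := oc u v (u' ++ b) (v' ++ b) a [::].
  by rewrite cats0 -e /psub /= !cats0; apply.
split=> [[_ G]|[G1 G2]].
- split=> u v u' v' a b uv uv' e; have [l _] := lead_binom uv; have [l' _] := lead_binom uv';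
    have [h1 h2] := G _ _ _ _ (ex_intro _ _ (ex_intro _ _ (conj uv erefl)))
      (ex_intro _ _ (ex_intro _ _ (conj uv' erefl))) l l'.
  + by move=> s; apply: rst_sym; apply: trivial_below (h1 _ _ e s) (oc _ _ _ _ _ _ e).
  + by apply: rst_sym; apply: trivial_below (h2 _ _ e) (ic _ _ _ _ _ _ e).
- split=> [_ [u [v [uv ->]]]|_ _ w w' [u [v [uv ->]]] [u' [v' [uv' ->]]]].
    by exists u; apply: lead_binom.
  move=> /(binom_lead uv) -> /(binom_lead uv') ->; split=> a b e => [s|].
  + by apply: below_trivial (oc _ _ _ _ _ _ e); apply: rst_sym; apply: G1 uv' e s.
  + by apply: below_trivial (ic _ _ _ _ _ _ e); apply: rst_sym; apply: G2 uv' e.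
Qed.

End Criterion.

(** Levi's lemma for words. *)
Lemma cat_eq_prefix (x y x' y' : seq X) : x ++ y = x' ++ y' -> (size x <= size x')%N ->
  exists2 r, x' = x ++ r & y = r ++ y'.
Proof.
move=> e s; exists (drop (size x) x').
  have := congr1 (take (size x)) e; rewrite take_size_cat // takel_cat // => {1}->.
  by rewrite cat_take_drop.
have := congr1 (drop (size x)) e; rewrite drop_size_cat // drop_cat.
case: ltnP => // s'; have ss : size x = size x' by apply/eqP; rewrite eqn_leq s s'.
by rewrite ss subnn drop0 drop_size.
Qed.

(** * The diamond lemma: unique normal forms from connected critical pairs *)

Hypothesis critical : critical_pairs_below.

(** Steps at disjoint places commute; otherwise the redexes overlap or are nested, and a critical
    pair applies inside a context. By symmetry of [below] the first redex may be taken to start no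
    later than the second. *)
Lemma local_below w x y : red w x -> red w y -> below w x y.
Proof.
have [C1 C2] := critical.
have wlog_prefix p u v q p' u' v' q' : (size p <= size p')%N -> rels u v -> rels u' v' ->
    p ++ u ++ q = p' ++ u' ++ q' -> below (p ++ u ++ q) (p ++ v ++ q) (p' ++ v' ++ q').
  move=> s uv uv' e; have [r ? e'] := cat_eq_prefix e s; subst p'.
  have [us|us] := leqP (size u) (size r).
    have [m ? ?] := cat_eq_prefix e' us; subst r q; rewrite -!catA.
    apply: joinable_below.
    - exists (p ++ v ++ m ++ v' ++ q').
        by have := red_step (p ++ v ++ m) q' uv'; rewrite -!catA; apply: rt_step.
      by apply/rt_step/red_step.
    - exact/lt_ctx/rels_lt.
    - by have := lt_ctx (p ++ u ++ m) q' (rels_lt uv'); rewrite -!catA.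
  have [t ? e''] := cat_eq_prefix (esym e') (ltnW us); subst u.
  (* [t] is the part of [u] from the start of the second redex on; being nonempty, it gives the
     strict length bound of an intersection. *)
  have t0 : (0 < size t)%N by move: us; rewrite size_cat -{1}[size r]addn0 ltn_add2l.
  have [ts|/ltnW ts] := leqP (size t) (size u').
    have [b ? ?] := cat_eq_prefix (esym e'') ts; subst u' q.
    have /(below_ctx p q') : below ((r ++ t) ++ b) (v ++ b) (r ++ v').
      by apply: C1 uv uv' _ _; rewrite ?catA // !size_cat ltn_add2l -{1}[size b]add0n ltn_add2r.
    by rewrite -!catA.
  have [b ? ?] := cat_eq_prefix e'' ts; subst t q'.
  by have /(below_ctx p q) := C2 _ _ _ _ _ _ uv uv' erefl; rewrite -!catA.
move=> [p u v q uv]; move E: (p ++ u ++ q) => w0 wy.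
case: wy E => p' u' v' q' uv' E.
have [s|/ltnW s] := leqP (size p) (size p'); first by rewrite -E; exact: wlog_prefix uv uv' E.
by apply: rst_sym; apply: wlog_prefix uv' uv (esym E).
Qed.

(** Newman-style induction on [w]: for words below [w] normal forms are unique, so reaching a given
    normal form is invariant along any connection below [w], and the two first steps from [w] are so
    connected. *)
Lemma normal_form_unique w z z' :
  reds w z -> reds w z' -> normal z -> normal z' -> z = z'.
Proof.
elim/(well_founded_ind lt_wf): w z z' => w IH z z' wz wz' nz nz'.
have nf x y r : below w x y -> normal r -> reds x r <-> reds y r.
  move=> xy nr; elim: xy => {x y} [x y [xy xw]|x|x y _ []|x y t _ [? ?] _ [? ?]]; try by split; auto.
  split=> [xr|yr]; last by apply: rt_trans yr; apply: rt_step.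
  have [r' yr' nr'] := normal_form_exists y.
  by rewrite (IH x xw r r') //; apply: rt_trans yr'; apply: rt_step.
move: nz; have := clos_rt_rt1n _ _ _ _ wz => {wz}; case=> [|x {}z wx /(clos_rt1n_rt _ _ _ _) xz] nz.
  by rewrite (reds_normal wz').
move: nz'; have := clos_rt_rt1n _ _ _ _ wz' => {wz'}; case=> [|y {}z' wy /(clos_rt1n_rt _ _ _ _) yz'] nz'.
  by case: (nz' _ wx).
apply: (IH x) => //; first exact: red_lt.
by apply/(nf x y) => //; apply: local_below.
Qed.

(** By uniqueness, the normal form reached is an invariant of the congruence class. *)
Lemma cong_normal x y : cong rels x y -> normal x -> normal y -> x = y.
Proof.
move=> xy nx ny.
suff H r : normal r -> reds x r <-> reds y r.
  by rewrite (reds_normal ((H y ny).2 (rt_refl _ _ y)) nx).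
move=> nr; elim: xy => {x y nx ny} [a b u v uv|x|x y _ []|x y t _ [? ?] _ [? ?]]; try by split; auto.
have st : reds (a ++ u ++ b) (a ++ v ++ b) by apply/rt_step/red_step.
split=> [xr|yr]; last exact: rt_trans yr.
have [r' yr' nr'] := normal_form_exists (a ++ v ++ b).
by rewrite (normal_form_unique xr (rt_trans _ _ _ _ _ st yr')).
Qed.

End Rewriting.

(** * Lexicographic and deg-lex orders *)

Section Lex.
Variables (T : eqType) (lt : rel T).
Implicit Types u v : seq T.

Lemma lexlt_cat u u' v v' : size u = size u' ->
  lexlt lt (u ++ v) (u' ++ v') = lexlt lt u u' || ((u == u') && lexlt lt v v').
Proof.
elim: u u' => [|x u IH] [|x' u'] //= [/IH ->].
by rewrite eqseq_cons; case: (x == x'); case: (lt x x').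
Qed.

Hypotheses (lt_irr : forall x, ~~ lt x x) (lt_trans : forall x y z, lt x y -> lt y z -> lt x z).

Lemma lexlt_irr u : ~~ lexlt lt u u.
Proof. by elim: u => //= x u IH; rewrite eqxx (negPf (lt_irr x)). Qed.

Lemma lexlt_trans u v w : lexlt lt u v -> lexlt lt v w -> lexlt lt u w.
Proof.
elim: u v w => [|x u IH] [|y v] [|z w] //=.
move=> /orP[xy|/andP[/eqP-> uv]] /orP[yz|/andP[/eqP<- vw]].
- by rewrite (lt_trans xy yz).
- by rewrite xy.
- by rewrite yz.
- by rewrite eqxx (IH _ _ uv vw) orbT.
Qed.

Lemma deglex_irr u : ~~ deglex lt u u.
Proof. by rewrite /deglex ltnn eqxx lexlt_irr. Qed.

Lemma deglex_trans u v w : deglex lt u v -> deglex lt v w -> deglex lt u w.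
Proof.
rewrite /deglex => /orP[s|/andP[/eqP-> h]] /orP[s'|/andP[/eqP <- h']].
- by rewrite (ltn_trans s s').
- by rewrite s.
- by rewrite s'.
- by rewrite eqxx (lexlt_trans h h') orbT.
Qed.

Lemma deglex_ctx a b u v : deglex lt u v -> deglex lt (a ++ u ++ b) (a ++ v ++ b).
Proof.
rewrite /deglex !size_cat ltn_add2l ltn_add2r eqn_add2l eqn_add2r.
case/orP=> [->//|/andP[/eqP s h]].
by rewrite s eqxx lexlt_cat // eqxx /= lexlt_cat // h !orbT.
Qed.

Hypothesis lt_wf : well_founded (fun x y => lt x y).

(** Unbounded lengths may allow infinite descent, so the length is fixed; the induction is on the
    head, then on the tail. *)
Lemma lexlt_wf n : well_founded (fun u v => size u = n /\ size v = n /\ lexlt lt u v).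
Proof.
elim: n => [|n IH].
  by move=> u; split=> v [/size0nil -> [/size0nil -> ]].
suff H x u : size u = n -> Acc (fun u v => size u = n.+1 /\ size v = n.+1 /\ lexlt lt u v) (x :: u).
  by move=> u; split=> -[|y v] [h _]; [discriminate h | apply: H; case: h].
elim/(well_founded_ind lt_wf): x u => x IHx u.
elim/(well_founded_ind IH): u => u IHu su.
split=> -[|y v] [sv [_ /=]]; first by [].
move: sv => [sv] /orP[yx|/andP[/eqP-> vu]]; first exact: IHx.
by apply: IHu.
Qed.

Lemma deglex_wf : well_founded (fun u v => deglex lt u v).
Proof.
move=> u; move: {2}(size u) (erefl (size u)) => n.
elim/ltn_ind: n u => n IHn u; elim/(well_founded_ind (lexlt_wf n)): u => u IHu su.
split=> v /orP[s|/andP[/eqP s l]]; first by apply: (IHn (size v)); rewrite -?su.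
by apply: IHu; rewrite ?s.
Qed.

End Lex.

(** * The tower order is a well-founded monomial order *)

Section Tower.
Variables (A : eqType) (oneA : A) (Y : eqType).
Variables (ltA1 : rel (A1 oneA)) (ltY : rel Y).
Implicit Types d : seq (letter oneA Y).

Lemma ys_cat d d' : ys (d ++ d') = ys d ++ ys d'.
Proof. exact: pmap_cat. Qed.

(** Equal words of [Y]-letters thus give block lists of equal length, which [lexlt_cat] and
    [lexlt_wf] require. *)
Lemma size_blocks d : size (blocks d) = (size (ys d)).+1.
Proof. by elim: d => //= -[a|y] d /=; [case: (blocks d) | move=> ->]. Qed.

(** [blocks] recurses from the left, whereas right multiplication affects the last block. *)
Lemma blocks_rcons_inl d a B e :
  blocks d = rcons B e -> blocks (rcons d (inl a)) = rcons B (rcons e a).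
Proof.
elim: d B e => [|[a'|y] d IH] B e /=.
- by case: B => [|? []] // [<-].
- case: B => [|b B] /=; have := size_blocks d.
    by case E: (blocks d) => [|e' [|]] //= _ [<-]; rewrite (IH [::] e').
  case E: (blocks d) => [|e' r] //= _ [<- r_e].
  by rewrite (IH (e' :: B) e) //= E r_e.
- case: B => [|b B] /= [<-]; last by move=> /IH ->.
  by move=> E; have := size_blocks d; rewrite E.
Qed.

Lemma blocks_rcons_inr d y : blocks (rcons d (inr y)) = rcons (blocks d) [::].
Proof.
elim: d => //= -[a|y'] d -> //=.
by have := size_blocks d; case: (blocks d).
Qed.

(** Comparing [t] and then the [Y]-letters amounts to deg-lex on the words of [Y]-letters. *)
Lemma towerE d d' : tower ltA1 ltY d d' =
  deglex ltY (ys d) (ys d') || ((ys d == ys d') && lexlt (deglex ltA1) (blocks d) (blocks d')).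
Proof.
rewrite /tower /deglex -orbA; case: ltnP => //= _; case: eqP => [//|ns] /=.
by case: eqP => // e; rewrite e in ns.
Qed.

Hypotheses (irrA : forall x, ~~ ltA1 x x) (irrY : forall x, ~~ ltY x x).
Hypotheses (trA : forall x y z, ltA1 x y -> ltA1 y z -> ltA1 x z)
  (trY : forall x y z, ltY x y -> ltY y z -> ltY x z).
Hypotheses (wfA : well_founded (fun x y => ltA1 x y)) (wfY : well_founded (fun x y => ltY x y)).

Lemma tower_irr d : ~~ tower ltA1 ltY d d.
Proof. by rewrite towerE negb_or deglex_irr // eqxx lexlt_irr // => x; apply: deglex_irr. Qed.

Lemma tower_trans d d' d'' : tower ltA1 ltY d d' -> tower ltA1 ltY d' d'' -> tower ltA1 ltY d d''.
Proof.
rewrite !towerE => /orP[s|/andP[/eqP-> h]] /orP[s'|/andP[/eqP <- h']].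
- by rewrite (deglex_trans trY s s').
- by rewrite s.
- by rewrite s'.
- by rewrite eqxx (lexlt_trans _ h h') ?orbT //; apply: deglex_trans.
Qed.

Lemma tower_cons l d d' : tower ltA1 ltY d d' -> tower ltA1 ltY (l :: d) (l :: d').
Proof.
rewrite !towerE; case/orP => [h|/andP[/eqP e h]].
  case: l => [a|y] /=; first by rewrite h.
  by have /(_ [:: y] [::]) := deglex_ctx _ _ h; rewrite !cats0 => ->.
have [s s'] := (size_blocks d, size_blocks d').
case: l => [a|y] /=; rewrite e eqxx /=; last by rewrite h !orbT.
case: (blocks d) (blocks d') s s' h => [|b r] [|b' r'] //= _ _.
rewrite eqseq_cons eqxx /= => /orP[/(deglex_ctx [:: a] [::])|-> ]; last by rewrite !orbT.
by rewrite !cats0 => ->; rewrite orbT.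
Qed.

Lemma tower_rcons l d d' : tower ltA1 ltY d d' -> tower ltA1 ltY (rcons d l) (rcons d' l).
Proof.
rewrite !towerE -!cats1 !ys_cat; case/orP => [h|/andP[/eqP e h]].
  by rewrite (@deglex_ctx _ _ [::] (ys [:: l])).
rewrite e eqxx /= !cats1; apply/orP; right.
have ss : size (blocks d) = size (blocks d') by rewrite !size_blocks e.
(* A [Y]-letter opens a new empty block; an [A1]-letter extends the last block, where deg-lex is
   stable. *)
case: l => [a|y]; last by rewrite !blocks_rcons_inr -!cats1 lexlt_cat // h.
have lastB (f : seq (letter oneA Y)) : exists B b, blocks f = rcons B b :> seq (seq (A1 oneA)).
  have := size_blocks f; case: (lastP (blocks f)) => [//|B b _]; by exists B, b.
have [[B [b E]] [B' [b' E']]] := (lastB d, lastB d').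
rewrite (blocks_rcons_inl a E) (blocks_rcons_inl a E').
move: h ss; rewrite E E' !size_rcons => + [ss].
rewrite -!cats1 !lexlt_cat // => /orP[->//|/andP[-> /=]].
rewrite !andbF !orbF => /(@deglex_ctx _ ltA1 [::] [:: a]) /= ->.
by rewrite orbT.
Qed.

Lemma tower_ctx p q d d' : tower ltA1 ltY d d' -> tower ltA1 ltY (p ++ d ++ q) (p ++ d' ++ q).
Proof.
move=> h; elim: p => [|l p IH] /=; last exact: tower_cons.
by elim/last_ind: q => [|q l IH]; rewrite ?cats0 // -!rcons_cat; apply: tower_rcons.
Qed.

(** Outer induction on the word of [Y]-letters under deg-lex; with it fixed, the number of blocks is
    constant and fixed-length lexicographic induction applies. *)
Lemma tower_wf : well_founded (fun d d' => tower ltA1 ltY d d').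
Proof.
move=> d; move: {2}(ys d) (erefl (ys d)) => u.
elim/(well_founded_ind (deglex_wf wfY)): u d => u IHu d.
move: {2}(blocks d) (erefl (blocks d)) => B.
elim/(well_founded_ind (lexlt_wf (deglex_wf wfA) (size u).+1)): B d => B IHB d eB eu.
split=> d'; rewrite towerE => /orP[h|/andP[/eqP e h]].
  by apply: (IHu (ys d')); rewrite -?eu.
by apply: (IHB (blocks d')); rewrite -?eB ?size_blocks ?e ?eu.
Qed.

End Tower.

(** * Elementary facts on groups and automorphisms *)

Section Group.
Variables (M : Type) (mul : M -> M -> M) (one : M) (inv : M -> M).
Hypothesis gM : is_group mul one inv.

Lemma group_cancel_l x y z : mul x y = mul x z -> y = z.
Proof.
case: gM => mA [m1 [_ [mV _]]] e.
by rewrite -[y]m1 -[z]m1 -(mV x) -!mA e.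
Qed.

Lemma aut_one f : is_aut mul f -> f one = one.
Proof.
case: gM => mA [m1 [_ [mV _]]] [fM _].
by apply: (@group_cancel_l (f one)); rewrite -fM m1; case: gM => _ [_ [-> _]].
Qed.

End Group.

(** * Reduction in the presentation of the extension *)

Section Extension.
Variables (A : eqType) (mulA : A -> A -> A) (oneA : A) (invA : A -> A).
Variables (Y : eqType) (psi : Y -> A -> A) (Omega : seq Y -> Prop) (h : seq Y -> seq Y).
Variables (fs : seq Y -> A).
Hypotheses (gA : is_group mulA oneA invA) (aut_psi : forall y, is_aut mulA (psi y)).
Local Notation aw := (@aw A oneA Y).
Local Notation yword := (@yword A oneA Y).
Local Notation rels := (@relsS A oneA Y mulA psi Omega h fs).
Local Notation redS := (reds rels).
Local Notation act := (actw psi).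
Local Notation rseq := (rseq oneA mulA psi Omega h fs).
Implicit Types (a b : A) (u v z : seq Y) (x : seq (letter oneA Y)).

Local Lemma mulAA a b c : mulA a (mulA b c) = mulA (mulA a b) c.
Proof. by case: gA. Qed.
Local Lemma mul1A a : mulA oneA a = a. Proof. by case: gA => _ []. Qed.
Local Lemma mulA1 a : mulA a oneA = a. Proof. by case: gA => _ [_ []]. Qed.

Lemma aw_one : aw oneA = [::].
Proof. by rewrite /Defs.aw insubN // negbK. Qed.

Lemma aw_letter (a : A1 oneA) : aw (val a) = [:: inl a].
Proof. by rewrite /Defs.aw valK. Qed.

Variant aw_spec a : seq (letter oneA Y) -> Prop :=
| AwOne of a = oneA : aw_spec a [::]
| AwLetter (a1 : A1 oneA) of a = val a1 : aw_spec a [:: inl a1].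

Lemma awP a : aw_spec a (aw a).
Proof.
rewrite /Defs.aw; case: insubP => [a1 _ <-|]; first exact: AwLetter.
by move/negPn/eqP; apply: AwOne.
Qed.

Lemma aw_inj : injective aw.
Proof. by move=> a b; case: awP => [->|a1 ->]; case: awP => [->|b1 ->] // [->]. Qed.

Lemma ys_aw a : ys (aw a) = [::].
Proof. by case: awP. Qed.

Lemma ys_yword u : ys (yword u) = u.
Proof. by elim: u => //= y u ->. Qed.

Lemma yword_cat u v : yword (u ++ v) = yword u ++ yword v.
Proof. exact: map_cat. Qed.

Lemma nform_inj u u' a a' : yword u ++ aw a = yword u' ++ aw a' -> u = u' /\ a = a'.
Proof.
move=> e; have eu : u = u' by have := congr1 (@ys A oneA Y) e; rewrite !ys_cat !ys_yword !ys_aw !cats0.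
by move: e; rewrite eu => /eqP; rewrite eqseq_cat // eqxx /= => /eqP /aw_inj.
Qed.

Lemma redS_mul a b : redS (aw a ++ aw b) (aw (mulA a b)).
Proof.
case: (awP a) => [->|a1 ->]; first by rewrite mul1A; apply: rt_refl.
case: (awP b) => [->|b1 ->]; first by rewrite mulA1 cats0 aw_letter; apply: rt_refl.
by apply: red_rel; left; exists a1, b1.
Qed.

Lemma redS_letter a y : redS (aw a ++ [:: inr y]) (inr y :: aw (psi y a)).
Proof.
case: (awP a) => [->|a1 ->].
  by rewrite (aut_one gA (aut_psi y)) aw_one; apply: rt_refl.
by apply: red_rel; right; right; exists a1, y.
Qed.

Lemma redS_act a u : redS (aw a ++ yword u) (yword u ++ aw (act a u)).
Proof.
elim: u a => [|y u IH] a /=; first by rewrite cats0; apply: rt_refl.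
have /= h1 := reds_catr (yword u) (redS_letter a y).
rewrite -catA in h1; apply: rt_trans h1 _.
exact: (reds_catl [:: inr y]).
Qed.

Lemma redS_mul_act u a v b : redS (yword u ++ aw a ++ yword v ++ aw b)
   (yword (u ++ v) ++ aw (mulA (act a v) b)).
Proof.
rewrite yword_cat -catA; apply: reds_catl.
apply: (rt_trans _ _ _ (yword v ++ aw (act a v) ++ aw b)).
  by rewrite !catA; apply/reds_catr/redS_act.
by apply/reds_catl/redS_mul.
Qed.

Lemma redS_Omega v : Omega v -> redS (yword v) (yword (h v) ++ aw (fs v)).
Proof. by move=> Ov; apply: red_rel; right; left; exists v. Qed.

(** A step at [p v q] leaves [(v)] between [h v] and [q]; carrying it past [q] turns it into
    [(v)^q]. Elements from later steps end up to its left, whence the order of the product. *)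
Lemma redS_rseq u z g : rseq u z g -> redS (yword u) (yword z ++ aw g).
Proof.
elim=> [x|p v q {}z {}g Ov _ IH]; first by rewrite aw_one cats0; apply: rt_refl.
have h1 := redS_mul_act (p ++ h v) (fs v) q oneA.
rewrite aw_one cats0 mulA1 in h1.
apply: (rt_trans _ _ _ (yword (p ++ h v) ++ aw (fs v) ++ yword q)).
  rewrite !yword_cat -!catA; apply: reds_catl; rewrite !catA.
  exact/reds_catr/redS_Omega.
apply: rt_trans h1 _; rewrite -catA.
apply: (rt_trans _ _ _ (yword z ++ aw g ++ aw (act (fs v) q))).
  by rewrite (catA (yword z)); apply: reds_catr.
exact/reds_catl/redS_mul.
Qed.

Lemma redS_rseq_mul u z g a : rseq u z g -> redS (yword u ++ aw a) (yword z ++ aw (mulA g a)).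
Proof.
move=> /redS_rseq /(reds_catr (aw a)) r; apply: rt_trans r _.
by rewrite -catA; apply/reds_catl/redS_mul.
Qed.

Lemma reds_rseq u z : reds (relsR Omega h) u z -> exists g, rseq u z g.
Proof.
move=> r; have {r} := clos_rt_rt1n _ _ _ _ r; elim=> [x|x y {}z [p v w q [Ov ->]] _ [g r]].
  by exists oneA; apply: rseq_nil.
by exists (mulA g (act (fs v) q)); apply: rseq_cons.
Qed.

Lemma rseq_reds u z g : rseq u z g -> reds (relsR Omega h) u z.
Proof.
elim=> [x|p v q {}z {}g Ov _ IH]; first exact: rt_refl.
by apply: rt_trans IH; apply/rt_step/red_step.
Qed.

Lemma normalR z : normal (relsR Omega h) z <-> R_irreducible Omega z.
Proof.
split=> [n p q v Ov e|n y r]; last first.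
  by case: r n => p v w q [Ov _] n; apply: (n p q v).
by apply: (n (p ++ h v ++ q)); rewrite e; apply: red_step.
Qed.

Hypothesis Omega_nil : ~ Omega [::].

(** A letter of [A1] can occur only at the very end, so no rule starting with one fits; a rule for
    [v] would project under [ys] to an occurrence of [v] in [z]. *)
Lemma normalS z a : R_irreducible Omega z -> normal rels (yword z ++ aw a).
Proof.
move=> nz y r; move: r; move E: (yword z ++ aw a) => x r.
case: r E => p u w q [[b [b' [-> _]]]|[[v [Ov [-> _]]]|[b [y' [-> _]]]]].
- elim: z p {nz} => [|y' z IH] [|l p] //=; last by case=> _ /IH.
    by case: awP.
  by case: awP => // a1 _; case: p.
- move=> E.
  apply: (nz (ys p) (ys q) v Ov).
  by have := congr1 (@ys A oneA Y) E; rewrite !ys_cat !ys_yword ys_aw cats0.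
- elim: z p {nz} => [|y'' z IH] [|l p] //=; last by case=> _ /IH.
    by case: awP.
  by case: awP => // a1 _; case: p.
Qed.

(** Deleting the letters of [A1] induces the projection from [G] to [B]. *)
Lemma cong_ys x x' : cong rels x x' -> cong (relsR Omega h) (ys x) (ys x').
Proof.
elim=> [p q u v uv|u|u v _|u v w _ H1 _ H2].
- rewrite !ys_cat; case: uv => [[b [b' [-> ->]]]|[[w [Ow [-> ->]]]|[b [y [-> ->]]]]].
  + by rewrite ys_aw; apply: cong_refl.
  + by rewrite ys_cat !ys_yword ys_aw cats0; apply: cong_step.
  + by rewrite /= ys_aw; apply: cong_refl.
- exact: cong_refl.
- exact: cong_sym.
- exact: cong_trans H1 H2.
Qed.

Lemma redS_Omega_mul v a : Omega v -> redS (yword v ++ aw a) (yword (h v) ++ aw (mulA (fs v) a)).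
Proof.
move=> /redS_Omega /(reds_catr (aw a)) r; apply: rt_trans r _.
by rewrite -catA; apply/reds_catl/redS_mul.
Qed.

(** This resolves the critical pair at [a v]; the left word is what remains once [a] has been
    carried past [v]. *)
Lemma joinable_act v a : Omega v -> mulA (fs v) (act a v) = mulA (act a (h v)) (fs v) ->
  joinable rels (yword v ++ aw (act a v)) (aw a ++ yword (h v) ++ aw (fs v)).
Proof.
move=> Ov e; exists (yword (h v) ++ aw (mulA (fs v) (act a v))); first exact: redS_Omega_mul.
by rewrite e; apply: (redS_mul_act [::]).
Qed.

Lemma yword_inl w p q (b : A1 oneA) : yword w = p ++ inl b :: q -> False.
Proof. by elim: w p => [|y w IH] [|l p] //= [_ /IH]. Qed.

Lemma yword_overlap_inl w p q r (b : A1 oneA) :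
  yword w ++ r = p ++ inl b :: q -> (size p < size w)%N -> False.
Proof. by elim: w p => [|y w IH] [|l p] //= [_ /IH]. Qed.

Lemma yword_catE w p q : yword w = p ++ q ->
  exists w1 w2, [/\ w = w1 ++ w2, p = yword w1 & q = yword w2].
Proof.
elim: p w => [|l p IH] w /=; first by move<-; exists [::], w.
case: w => [|y w] //= [<- /IH [w1 [w2 [-> -> ->]]]].
by exists (y :: w1), w2.
Qed.

(** * Joinability of the critical pairs of [S] *)

Section Joinable.
Hypothesis cond1 : forall v a, Omega v ->
  mulA (fs v) (act a v) = mulA (act a (h v)) (fs v).
Hypothesis overlapR : forall v1 v2 c d, Omega v1 -> Omega v2 -> v1 ++ c = d ++ v2 ->
  (size (v1 ++ c) < size v1 + size v2)%N -> exists z g1 g2,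
  [/\ rseq (d ++ h v2) z g1, rseq (h v1 ++ c) z g2 &
      mulA g1 (fs v2) = mulA g2 (act (fs v1) c)].
Hypothesis minimalR : forall v v', Omega v -> Omega v' -> v <> v' ->
  ~ exists p q, v' = p ++ v ++ q.

Lemma joinable_refl x : joinable rels x x.
Proof. by exists x; apply: rt_refl. Qed.

(** Of the nine pairs of rules, four give nontrivial overlaps: [a a' a''] by associativity, [a a' y]
    by multiplicativity of [psi y], two rules of [R] by [overlapR], and [a v] by [cond1]. *)
Lemma joinable_overlap (u v u' v' p q : seq (letter oneA Y)) : rels u v -> rels u' v' -> u ++ q = p ++ u' ->
  (size (u ++ q) < size u + size u')%N -> joinable rels (v ++ q) (p ++ v').
Proof.
move=> uv uv' e s.
have sp : (size p < size u)%N by move: s; rewrite e size_cat ltn_add2r.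
case: uv e s sp => [[b1 [b2 [-> ->]]]|[[w [Ow [-> ->]]]|[b1 [y [-> ->]]]]];
  case: uv' => [[b3 [b4 [-> ->]]]|[[w' [Ow' [-> ->]]]|[b3 [y' [-> ->]]]]] e s sp.
- case: p e sp s => [|l [|? ?]] //= [? ?]; first by move=> -> *; subst; rewrite cats0; apply: joinable_refl.
  move=> -> _ _; subst; rewrite -!aw_letter.
  exists (aw (mulA (mulA (val b1) (val b3)) (val b4))); first exact: redS_mul.
  by have := redS_mul (val b1) (mulA (val b3) (val b4)); rewrite aw_letter mulAA.
- by case: w' Ow' e s sp => [/Omega_nil|y w' _] //; case: p => [|l [|? ?]].
- case: p e sp s => [|l [|? ?]] //= [? [? ->]] _ _; subst.
  exists (inr y' :: aw (psi y' (mulA (val b1) (val b3)))); first exact: redS_letter.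
  have := redS_mul_act [::] (val b1) [:: y'] (psi y' (val b3)).
  by rewrite aw_letter /=; case: (aut_psi y') => -> _.
- by case: (yword_overlap_inl e); move: sp; rewrite size_map.
(* Both leading words consist of [Y]-letters, hence so do [p] and [q], and the overlap is one of
   leading words of [R]. *)
- have [r e1 e2] := cat_eq_prefix (esym e) (ltnW sp).
  have [d [r' [? ? ?]]] := yword_catE e1; subst p r w.
  have [r2 [c [? er ?]]] := yword_catE e2; subst q w'.
  have {er} ? : r' = r2 by rewrite -[r']ys_yword er ys_yword.
  subst r2.
  have [||z [g1 [g2 [r1 r2 eg]]]] := @overlapR _ _ c d Ow Ow'; first by rewrite catA.
    by move: s; rewrite !(size_cat, size_map).
  exists (yword z ++ aw (mulA g1 (fs (r' ++ c)))); last first.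
    by rewrite catA -yword_cat; apply: redS_rseq_mul.
  have := redS_mul_act (h (d ++ r')) (fs (d ++ r')) c oneA.
  rewrite aw_one cats0 mulA1 -catA => h1; apply: rt_trans h1 _.
  by rewrite eg; apply: redS_rseq_mul.
- by case: (yword_overlap_inl e); move: sp; rewrite size_map.
- by case: p e sp s => [|l [|? ?]].
- case: p e sp s => [|l [|? ?]] //=; first by case: w' Ow' => [/Omega_nil|].
  (* The [y] of [a y] is the first letter of the leading word; carrying [a] on past the rest [c]
     leads to [joinable_act]. *)
  move=> [<-]; case: w' Ow' => [/Omega_nil|y1 c Ow'] //= [? ->] _ _; subst y1.
  have [t t1 t2] := joinable_act Ow' (cond1 (val b1) Ow').
  exists t; last by rewrite aw_letter in t2.
  apply: rt_trans t1; have /= := redS_mul_act [:: y] (psi y (val b1)) c oneA.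
  by rewrite aw_one cats0 mulA1.
- case: p e sp s => [|l [|? ?]] //= [? ? ?] _ _; subst; rewrite cats0; exact: joinable_refl.
Qed.

(** Minimality reduces inclusions within [R] to coincidences. Apart from coinciding leading words
    there remains only [a y] with [y] itself a leading word of [R], settled by [cond1]. *)
Lemma joinable_inclusion (u v u' v' p q : seq (letter oneA Y)) : rels u v -> rels u' v' -> u = p ++ u' ++ q ->
  joinable rels v (p ++ v' ++ q).
Proof.
case=> [[b1 [b2 [-> ->]]]|[[w [Ow [-> ->]]]|[b1 [y [-> ->]]]]];
  case=> [[b3 [b4 [-> ->]]]|[[w' [Ow' [-> ->]]]|[b3 [y' [-> ->]]]]].
- case: p => [|l [|? [|? ?]]] //= [? ? ?]; subst; rewrite cats0; exact: joinable_refl.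
- by case: w' Ow' => [/Omega_nil|y w' _] //; case: p => [|l [|? [|? ?]]].
- by case: p => [|l [|? [|? ?]]].
- by move=> /yword_inl.
- move=> /yword_catE [w1 [w2 [? -> e]]]; have [w3 [w4 [? e3 ?]]] := yword_catE (esym e).
  subst w w2 q; have {e3} ? : w' = w3 by rewrite -[w']ys_yword e3 ys_yword.
  subst w3.
  have [ew|nw] := EM (w' = w1 ++ w' ++ w4); last first.
    by case: (minimalR Ow' Ow nw); exists w1, w4.
  have := congr1 size ew; rewrite !size_cat addnCA -[X in X = _]addn0 => /addnI.
  case: w1 w4 {ew e} Ow => [|? ?] [|? ?] //= Ow _; rewrite !cats0; exact: joinable_refl.
- by move=> /yword_inl.
- by case: p => [|l [|? [|? ?]]].
- case: w' Ow' => [/Omega_nil|y1 w' Ow'] //; case: p => [|l [|? [|? ?]]] //= [<- ?]; subst y1.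
  case: w' Ow' => // Ow' /= <-; rewrite cats0.
  by have := joinable_act Ow' (cond1 (val b1) Ow'); rewrite aw_letter.
- by case: p => [|l [|? [|? ?]]] //= [? ? ?]; subst; rewrite cats0; exact: joinable_refl.
Qed.

End Joinable.

Section Order.
Variables (ltY : rel Y) (ltA1 : rel (A1 oneA)).
Hypotheses (woY : strict_total_wo ltY) (woA1 : strict_total_wo ltA1).
Hypothesis h_lt : forall v, Omega v -> deglex ltY (h v) v.

(** Multiplication in [A] shortens a block, a rule of [R] lowers the word of [Y]-letters, and moving
    [a] past [y] keeps that word but shortens the first block. *)
Lemma relsS_lt (u v : seq (letter oneA Y)) : rels u v -> tower ltA1 ltY v u.
Proof.
case: woY woA1 => [irrY [trY _]] [irrA [trA _]].
case=> [[b1 [b2 [-> ->]]]|[[w [Ow [-> ->]]]|[b1 [y [-> ->]]]]]; rewrite towerE.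
- by rewrite ys_aw /=; case: awP.
- by rewrite ys_cat !ys_yword ys_aw cats0 h_lt.
- by rewrite /= ys_aw eqxx /= orbT.
Qed.

End Order.

End Extension.

(** * Equivalence with conditions (1) and (2), and the structure of [G] *)

Unset Implicit Arguments. Set Strict Implicit.

Theorem theorem2p1 (k : fieldType)
  (A : eqType) (mulA : A -> A -> A) (oneA : A) (invA : A -> A)
  (Y : eqType) (ltY : rel Y) (ltA1 : rel (A1 oneA))
  (Omega : seq Y -> Prop) (h : seq Y -> seq Y)
  (psi : Y -> A -> A) (fs : seq Y -> A) :
  (* A is a group *)
  is_group mulA oneA invA ->
  (* the orders on Y and on A_1 *)
  strict_total_wo ltY -> strict_total_wo ltA1 ->
  (* B = sgp<Y | R> is a group *)
  monoid_is_group (relsR Omega h) ->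
  (* R is a minimal Gröbner–Shirshov basis w.r.t. deg-lex *)
  (forall v, Omega v -> deglex ltY (h v) v) ->
  GSB (deglex ltY) (polys k (relsR Omega h)) ->
  (forall v v', Omega v -> Omega v' -> v <> v' -> ~ exists p q, v' = p ++ v ++ q) ->
  (* psi_y are automorphisms of A *)
  (forall y, is_aut mulA (psi y)) ->
  (* (v) = 1 whenever v = h_v is  y y' = 1 *)
  (forall v y y', Omega v -> v = [:: y; y'] -> h v = [::] -> fs v = oneA) ->
  let eqB := cong (relsR Omega h) in
  let rels := @relsS A oneA Y mulA psi Omega h fs in
  let eqG := cong rels in
  let cond1 := forall v a, Omega v ->
      mulA (fs v) (actw psi a v) = mulA (actw psi a (h v)) (fs v) in
  let cond2 := forall v1 v2 c d z g1 g2,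
      Omega v1 -> Omega v2 -> v1 ++ c = d ++ v2 ->
      (size (v1 ++ c) < size v1 + size v2)%N ->
      R_irreducible Omega z ->
      rseq oneA mulA psi Omega h fs (d ++ h v2) z g1 ->
      rseq oneA mulA psi Omega h fs (h v1 ++ c) z g2 ->
      mulA g1 (fs v2) = mulA g2 (actw psi (fs v1) c) in
  (GSB (tower ltA1 ltY) (polys k rels) <-> cond1 /\ cond2) /\
  (cond1 -> cond2 ->
     (* G is a group *)
     monoid_is_group rels /\
     (* a |-> a is an injective homomorphism A -> G *)
     (forall a a', eqG (aw oneA Y a ++ aw oneA Y a') (aw oneA Y (mulA a a'))) /\
     (forall a a', eqG (aw oneA Y a) (aw oneA Y a') -> a = a') /\
     (* its image is normal in G *)
     (forall (x : seq (letter oneA Y)) a, exists a', eqG (x ++ aw oneA Y a) (aw oneA Y a' ++ x)) /\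
     (* y |-> y induces an isomorphism B ~= G/A *)
     (forall u u', eqB u u' <-> exists a, eqG (yword oneA u) (yword oneA u' ++ aw oneA Y a)) /\
     (forall x, exists u a, eqG x (yword oneA u ++ aw oneA Y a)) /\
     (* unique normal form  b a *)
     (forall x, exists b a, R_irreducible Omega b /\ eqG x (yword oneA b ++ aw oneA Y a)) /\
     (forall b a b' a', R_irreducible Omega b -> R_irreducible Omega b' ->
        eqG (yword oneA b ++ aw oneA Y a) (yword oneA b' ++ aw oneA Y a') -> b = b' /\ a = a')).
Proof.
move=> gA woY woA1 gB h_lt gsbR minimalR aut_psi _ eqB rels eqG cond1 cond2.
have Omega_nil : ~ Omega [::].
  by move=> /h_lt; case: (h [::]) => [|? ?]; rewrite /deglex.
have mulAA a b c : mulA a (mulA b c) = mulA (mulA a b) c by case: gA.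
have mulA1 a : mulA a oneA = a by case: gA => _ [_ []].
have mulVA a : mulA (invA a) a = oneA by case: gA => _ [_ [_ []]].
have mulAV a : mulA a (invA a) = oneA by case: gA => _ [_ [_ []]].
have [irrY [trY [_ wfY]]] := woY; have [irrA [trA [_ wfA]]] := woA1.
have irrD := @deglex_irr _ _ irrY; have trD := @deglex_trans _ _ trY.
have ctxD := @deglex_ctx _ ltY; have wfD := deglex_wf wfY.
have relsR_lt u v : relsR Omega h u v -> deglex ltY v u by case=> Ou ->; apply: h_lt.
have irrS := @tower_irr _ oneA Y ltA1 ltY irrA irrY.
have trS := @tower_trans _ oneA Y ltA1 ltY trA trY.
have ctxS := @tower_ctx _ oneA Y ltA1 ltY.
have wfS := @tower_wf _ oneA Y ltA1 ltY wfA wfY.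
have relsS_lt u v : rels u v -> tower ltA1 ltY v u by apply: relsS_lt.
have critR := (GSB_critical_pairs irrD trD relsR_lt k).1 gsbR.
have critS := GSB_critical_pairs irrS trS relsS_lt k.
have redO v : Omega v -> reds rels (yword oneA v) (yword oneA (h v) ++ aw oneA Y (fs v)).
  exact: redS_Omega.
have red_act a u : reds rels (aw oneA Y a ++ yword oneA u) (yword oneA u ++ aw oneA Y (actw psi a u)).
  exact: (redS_act Omega h fs gA aut_psi).
have red_Omega_mul v a : Omega v ->
    reds rels (yword oneA v ++ aw oneA Y a) (yword oneA (h v) ++ aw oneA Y (mulA (fs v) a)).
  by apply: redS_Omega_mul; exact: gA.
have red_rseq_mul u z g a : rseq oneA mulA psi Omega h fs u z g ->
    reds rels (yword oneA u ++ aw oneA Y a) (yword oneA z ++ aw oneA Y (mulA g a)).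
  by apply: redS_rseq_mul; first exact: gA.
have red_mul_act u a v b : reds rels (yword oneA u ++ aw oneA Y a ++ yword oneA v ++ aw oneA Y b)
    (yword oneA (u ++ v) ++ aw oneA Y (mulA (actw psi a v) b)).
  exact: (redS_mul_act Omega h fs gA aut_psi).
have nfR u : exists z g, R_irreducible Omega z /\ rseq oneA mulA psi Omega h fs u z g.
  have [z /(reds_rseq mulA oneA psi fs) [g r] /normalR nz] := normal_form_exists ctxD wfD relsR_lt u.
  by exists z, g.
have nform_unique b a b' a' : GSB (tower ltA1 ltY) (polys k rels) ->
    R_irreducible Omega b -> R_irreducible Omega b' ->
    eqG (yword oneA b ++ aw oneA Y a) (yword oneA b' ++ aw oneA Y a') -> b = b' /\ a = a'.
  move=> /critS crS nb nb' e; apply: nform_inj.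
  by apply: (cong_normal trS ctxS wfS relsS_lt crS e); apply: normalS.
have iffS : GSB (tower ltA1 ltY) (polys k rels) <-> cond1 /\ cond2.
  split=> [gsbS|[c1 c2]].
    split=> [v a Ov|v1 v2 c d z g1 g2 O1 O2 e s nz r1 r2].
      (* [h v] may itself be reducible, so it is taken to its normal form [z]; the same [g] then
         stands on the left in both evaluations of [a v] and cancels. *)
      have [z [g [nz r]]] := nfR (h v).
      have e1 : eqG (aw oneA Y a ++ yword oneA v)
          (yword oneA z ++ aw oneA Y (mulA g (mulA (fs v) (actw psi a v)))).
        apply: reds_cong; apply: reds_trans (red_act _ _) _.
        by apply: reds_trans (red_Omega_mul _ _ Ov) _; apply: red_rseq_mul.
      have e2 : eqG (aw oneA Y a ++ yword oneA v)
          (yword oneA z ++ aw oneA Y (mulA g (mulA (actw psi a (h v)) (fs v)))).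
        apply: reds_cong; apply: reds_trans (reds_catl _ (redO _ Ov)) _.
        apply: reds_trans (red_mul_act [::] a (h v) (fs v)) _.
        exact: red_rseq_mul.
      have [_] := nform_unique _ _ _ _ gsbS nz nz (cong_trans (cong_sym e1) e2).
      exact: (group_cancel_l gA).
    (* The overlap word is evaluated in [G] through [v2] and through [v1]; both give [z] followed by
       an element of [A]. *)
    have e1 : eqG (yword oneA (v1 ++ c)) (yword oneA z ++ aw oneA Y (mulA g1 (fs v2))).
      rewrite e; apply: reds_cong; rewrite yword_cat.
      apply: reds_trans (reds_catl _ (redO _ O2)) _.
      by rewrite catA -yword_cat; apply: red_rseq_mul.
    have e2 : eqG (yword oneA (v1 ++ c)) (yword oneA z ++ aw oneA Y (mulA g2 (actw psi (fs v1) c))).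
      apply: reds_cong; rewrite yword_cat.
      apply: reds_trans (reds_catr _ (redO _ O1)) _.
      have := red_mul_act (h v1) (fs v1) c oneA.
      rewrite aw_one cats0 mulA1 -catA => r; apply: reds_trans r _.
      exact: red_rseq_mul.
    by have [] := nform_unique _ _ _ _ gsbS nz nz (cong_trans (cong_sym e1) e2).
  have overlapR v1 v2 c d : Omega v1 -> Omega v2 -> v1 ++ c = d ++ v2 ->
      (size (v1 ++ c) < size v1 + size v2)%N -> exists z g1 g2,
      [/\ rseq oneA mulA psi Omega h fs (d ++ h v2) z g1,
          rseq oneA mulA psi Omega h fs (h v1 ++ c) z g2 &
          mulA g1 (fs v2) = mulA g2 (actw psi (fs v1) c)].
    move=> O1 O2 e s.
    have [z1 [g1 [n1 r1]]] := nfR (d ++ h v2); have [z2 [g2 [n2 r2]]] := nfR (h v1 ++ c).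
    (* Both sides represent the overlap word in [B], so uniqueness of normal forms for [R] gives a
       common [z], to which [cond2] applies. *)
    have cg : eqB z1 z2.
      apply: (cong_trans (v := d ++ h v2)); first exact/cong_sym/reds_cong/rseq_reds/r1.
      apply: (cong_trans (v := h v1 ++ c)); last exact/reds_cong/rseq_reds/r2.
      apply: (cong_trans (v := d ++ v2)).
        apply: cong_sym; have := cong_step d [::] (conj O2 (erefl (h v2)) : relsR Omega h _ _).
        by rewrite !cats0.
      rewrite -e; exact: (cong_step [::] c (conj O1 (erefl (h v1)) : relsR Omega h _ _)).
    have ez : z1 = z2.
      by apply: (cong_normal trD ctxD wfD relsR_lt critR cg); apply/normalR.
    by subst z2; exists z1, g1, g2; split=> //; apply: c2 e s n1 r1 r2.
  apply/critS; split=> u v u' v' p q uv uv' e => [s|].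
    apply: (joinable_below trS ctxS relsS_lt).
    - exact: (joinable_overlap gA aut_psi Omega_nil c1 overlapR uv uv' e s).
    - exact: (ctxS [::] q _ _ (relsS_lt _ _ uv)).
    - by rewrite e; have := ctxS p [::] _ _ (relsS_lt _ _ uv'); rewrite !cats0.
  apply: (joinable_below trS ctxS relsS_lt).
  - exact: (joinable_inclusion gA aut_psi Omega_nil c1 minimalR uv uv' e).
  - exact: relsS_lt.
  - by rewrite e; apply/ctxS/relsS_lt.
split=> // c1 c2; have gsbS := iffS.2 (conj c1 c2).
have eq_ctx p q x y : eqG x y -> eqG (p ++ x ++ q) (p ++ y ++ q).
  elim=> [a b u v uv|?|? ? _|? ? ? _ e1 _ e2]; last exact: cong_trans e1 e2.
  - by have := cong_step (p ++ a) (b ++ q) uv; rewrite -!catA.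
  - exact: cong_refl.
  - exact: cong_sym.
have eq_catl p x y : eqG x y -> eqG (p ++ x) (p ++ y).
  by move=> /(eq_ctx p [::]); rewrite !cats0.
have eq_catr q x y : eqG x y -> eqG (x ++ q) (y ++ q) by apply: (eq_ctx [::]).
have eq_mul a b : eqG (aw oneA Y a ++ aw oneA Y b) (aw oneA Y (mulA a b)).
  by apply: reds_cong; apply: redS_mul; exact: gA.
have nil_irreducible : R_irreducible Omega [::].
  by move=> [|? ?] // [|? ?] [|? ?] // /Omega_nil.
(* Equality in [B] holds in [G] up to a right factor in [A]: each use of [v = h v] leaves [(v)],
   which is carried past the letters after it. *)
have lift u u' : eqB u u' -> exists a, eqG (yword oneA u) (yword oneA u' ++ aw oneA Y a).
  elim=> [p q v w [Ov ->]|v|v w _ [a e]|v w t _ [a e1] _ [b e2]].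
  - exists (actw psi (fs v) q); rewrite !yword_cat.
    apply: (cong_trans (eq_ctx _ _ _ _ (reds_cong (redO _ Ov)))).
    by rewrite -!catA; apply: (eq_catl); apply/eq_catl/reds_cong/red_act.
  - by exists oneA; rewrite aw_one cats0; apply: cong_refl.
  - exists (invA a); apply: cong_sym; apply: (cong_trans (eq_catr _ _ _ e)).
    rewrite -catA; apply: (cong_trans (eq_catl _ _ _ (eq_mul _ _))).
    by rewrite mulAV aw_one cats0; apply: cong_refl.
  - exists (mulA b a); apply: (cong_trans e1).
    apply: (cong_trans (eq_catr _ _ _ e2)); rewrite -catA.
    exact/eq_catl/eq_mul.
have form x : exists u a, eqG x (yword oneA u ++ aw oneA Y a).
  elim/last_ind: x => [|x l [u [a e]]].
    by exists [::], oneA; rewrite aw_one; apply: cong_refl.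
  rewrite -cats1; case: l => [b|y].
    exists u, (mulA a (val b)); apply: (cong_trans (eq_catr _ _ _ e)).
    by rewrite -catA -(aw_letter _ b); apply/eq_catl/eq_mul.
  exists (u ++ [:: y]), (psi y a); apply: (cong_trans (eq_catr _ _ _ e)).
  by rewrite yword_cat -!catA; apply/eq_catl/reds_cong/(redS_letter _ _ _ gA).
have rinv x : exists y, eqG (x ++ y) [::].
  have [u [a e]] := form x; have [u' [uu' _]] := gB u; have [b e'] := lift _ _ uu'.
  (* With [x = u a] and [u u' = b] in [G], a right inverse of [x] is the inverse of [a], then [u'],
     then the inverse of [b]. *)
  exists (aw oneA Y (invA a) ++ yword oneA u' ++ aw oneA Y (invA b)).
  apply: (cong_trans (eq_catr _ _ _ e)).
  apply: (cong_trans (v := yword oneA u ++ yword oneA u' ++ aw oneA Y (invA b))).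
    rewrite -catA; apply: eq_catl; rewrite catA; apply: (eq_catr _ _ [::]).
    by apply: (cong_trans (eq_mul _ _)); rewrite mulAV aw_one; apply: cong_refl.
  rewrite catA -yword_cat; apply: (cong_trans (eq_catr _ _ _ e')).
  by apply: (cong_trans (eq_mul _ _)); rewrite mulAV aw_one; apply: cong_refl.
split.
  move=> x; have [y xy] := rinv x; have [z yz] := rinv y; exists y; split=> //.
  (* Since [x = x y z = z], the right inverse [y] of [x] is also a left inverse. *)
  have xz : eqG x z.
    have := eq_catl x _ _ yz; rewrite cats0 => /cong_sym e; apply: (cong_trans e).
    by rewrite catA; apply: (eq_catr _ _ [::]).
  exact: cong_trans (eq_catl y _ _ xz) yz.
split=> //; split.
  by move=> a a' e; have [] := nform_unique [::] a [::] a' gsbS nil_irreducible nil_irreducible e.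
split.
  (* Normality reduces to conjugation by a single letter. *)
  elim=> [|l x IH] a; first by exists a; rewrite cats0; apply: cong_refl.
  have [a' e] := IH a; have {e} e := eq_catl [:: l] _ _ e.
  suff [a'' e'] : exists a'', eqG ([:: l] ++ aw oneA Y a') (aw oneA Y a'' ++ [:: l]).
    exists a''; apply: (cong_trans e); rewrite catA.
    by apply: (cong_trans (eq_catr _ _ _ e')); rewrite -catA; apply: cong_refl.
  case: l {e} => [b|y].
    exists (mulA (mulA (val b) a') (invA (val b))).
    rewrite -(aw_letter _ b); apply: (cong_trans (eq_mul _ _)).
    apply: cong_sym; apply: (cong_trans (eq_mul _ _)).
    by rewrite -mulAA mulVA mulA1; apply: cong_refl.
  (* The relation [a y = y a^y] read backwards makes conjugation by [y] the inverse of [psi y]. *)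
  have [_ [f _ fK]] := aut_psi y; exists (f a'); apply: cong_sym.
  by rewrite -{2}(fK a'); apply/reds_cong/(redS_letter _ _ _ gA).
split.
  (* This gives well-definedness and injectivity of the map from [B] to [G/A]; surjectivity is
     [form]. *)
  move=> u u'; split=> [/lift //|[a /cong_ys]].
  by rewrite ys_cat !ys_yword ys_aw cats0.
split=> //; split.
  move=> x; have [u [a e]] := form x; have [z [g [nz r]]] := nfR u.
  exists z, (mulA g a); split=> //; apply: (cong_trans e).
  exact/reds_cong/red_rseq_mul.
by move=> b a b' a' nb nb'; apply: nform_unique.
Qed.
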